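(* Let $((\mathbf{u},p),(\boldsymbol{\phi},r),\mathbf{y})\in V\times V\times Q_{ad}$ solve the continuous optimality system and let $((\mathbf{u}_h,p_h),(\boldsymbol{\phi}_h,r_h),\mathbf{y}_h)\in V_h\times V_h\times Q_{ad}^h$ solve the discrete optimality system (both written out in the context). Let $R\mathbf u,\bar R\boldsymbol\phi\in X$ and $\bar R_0r\in M$ be the reconstructions defined in the context. Then there is a constant $C>0$, independent of the mesh-size, such that $$\|r-r_h\|_M\le C\big(\|\bar R_0r-r_h\|_M+\|E_h\boldsymbol\phi_h-\Pi_h(E_h\boldsymbol\phi_h)\|_Q+\|R\mathbf u-\mathbf u_h\|_h+\|\boldsymbol\phi_h-\bar R\boldsymbol\phi\|_h\big).$$
   Context: All vector spaces are real. Continuous setting. $X,M,W,Q$ are Hilbert spaces, $V=X\times M$, with $X\subset W\subset X'$ with continuous inclusions ($X'$ the dual of $X$). $E:X\to Q$ is continuous and linear; $Q_{ad}\subset Q$ is nonempty, closed and convex. $\mathbf f,\mathbf u_d\in W$ and $\lambda>0$ are given. $a:X\times X\to\mathbb R$, $b:X\times M\to\mathbb R$ are continuous bilinear forms with $|a(\mathbf v,\mathbf z)|\le C_1\|\mathbf v\|_X\|\mathbf z\|_X$ and $|b(\mathbf z,p)|\le C_2\|\mathbf z\|_X\|p\|_M$; with $Z=\{\mathbf v\in X: b(\mathbf v,w)=0\ \forall w\in M\}$, $a$ is $Z$-elliptic: $\alpha\|\mathbf v\|_X^2\le a(\mathbf v,\mathbf v)$ for all $\mathbf v\in Z$, $\alpha>0$;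 and $b$ satisfies the inf-sup condition $\inf_{p\in M}\sup_{\mathbf z\in X} b(\mathbf z,p)/(\|\mathbf z\|_X\|p\|_M)\ge\beta>0$. Continuous optimality system for $((\mathbf u,p),(\boldsymbol\phi,r),\mathbf y)\in V\times V\times Q_{ad}$: for all $\mathbf z\in X$, $w\in M$, $\mathbf x\in Q_{ad}$, $a(\mathbf u,\mathbf z)+b(\mathbf z,p)=\langle\mathbf y,E\mathbf z\rangle_Q+\langle\mathbf f,\mathbf z\rangle_W$, $b(\mathbf u,w)=0$, $a(\mathbf z,\boldsymbol\phi)-b(\mathbf z,r)=\langle\mathbf u-\mathbf u_d,\mathbf z\rangle_W$, $b(\boldsymbol\phi,w)=0$, $\langle E\boldsymbol\phi+\lambda\mathbf y,\mathbf x-\mathbf y\rangle_Q\ge0$. Discrete setting. $X_h\subset W$ is a finite dimensional subspace, $\|\cdot\|_h$ is a norm on $X+X_h$ with $\|\mathbf v\|_h=\|\mathbf v\|_X$ for $\mathbf v\in X$; $M_h\subset M$ is a finite dimensional subspace with norm $\|\cdot\|_M$; $V_h=X_h\times M_h$; $Q_h\subseteq Q$ is a finite dimensional subspace and $Q_{ad}^h\subset Q_{ad}$ is a nonempty closed convex subset of $Q_h$. $a_h:X_h\times X_h\to\mathbb R$, $b_h:X_h\times M_h\to\mathbb R$ are bilinear with $|a_h(\mathbf v_h,\mathbf z_h)|\le\bar C_1\|\mathbf v_h\|_h\|\mathbf z_h\|_h$, $|b_h(\mathbf z_h,p_h)|\le\bar C_2\|\mathbf z_h\|_h\|p_h\|_M$;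 with $Z_h=\{\mathbf v_h\in X_h:b_h(\mathbf v_h,w_h)=0\ \forall w_h\in M_h\}$, $\bar\alpha\|\mathbf v_h\|_h^2\le a_h(\mathbf v_h,\mathbf v_h)$ on $Z_h$, $\bar\alpha>0$; and $\inf_{p_h\in M_h}\sup_{\mathbf z_h\in X_h}b_h(\mathbf z_h,p_h)/(\|\mathbf z_h\|_h\|p_h\|_M)\ge\bar C>0$. $E_h:X_h+X\to Q$ is linear with $E_h\mathbf v=E\mathbf v$ for $\mathbf v\in X$. Discrete optimality system for $((\mathbf u_h,p_h),(\boldsymbol\phi_h,r_h),\mathbf y_h)\in V_h\times V_h\times Q_{ad}^h$: for all $\mathbf z_h\in X_h$, $w_h\in M_h$, $\mathbf x_h\in Q_{ad}^h$, $a_h(\mathbf u_h,\mathbf z_h)+b_h(\mathbf z_h,p_h)=\langle\mathbf y_h,E_h\mathbf z_h\rangle_Q+\langle\mathbf f,\mathbf z_h\rangle_W$, $b_h(\mathbf u_h,w_h)=0$, $a_h(\mathbf z_h,\boldsymbol\phi_h)-b_h(\mathbf z_h,r_h)=\langle\mathbf u_h-\mathbf u_d,\mathbf z_h\rangle_W$, $b_h(\boldsymbol\phi_h,w_h)=0$, $\langle E_h\boldsymbol\phi_h+\lambda\mathbf y_h,\mathbf x_h-\mathbf y_h\rangle_Q\ge0$. Standing assumptions. (I) $\|\mathbf v\|_W\le C_W\|\mathbf v\|_h$ for all $\mathbf v\in X+X_h$. (II) $\|E_h(\mathbf v-\mathbf v_h)\|_Q\le\|\mathbf v-\mathbf v_h\|_h$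 for all $\mathbf v\in X,\mathbf v_h\in X_h$. (III) $\Pi_h:Q\to Q_h$ is the $Q$-orthogonal projection, and $\Pi_h\mathbf x\in Q_{ad}^h$ whenever $\mathbf x\in Q_{ad}$. Reconstructions. $(R\mathbf u,R_0p),(\bar R\boldsymbol\phi,\bar R_0r)\in X\times M$ are the unique solutions of: for all $\mathbf z\in X$, $w\in M$, $a(R\mathbf u,\mathbf z)+b(\mathbf z,R_0p)=\langle\mathbf y_h,E\mathbf z\rangle_Q+\langle\mathbf f,\mathbf z\rangle_W$, $b(R\mathbf u,w)=0$, $a(\mathbf z,\bar R\boldsymbol\phi)-b(\mathbf z,\bar R_0r)=\langle\mathbf u_h-\mathbf u_d,\mathbf z\rangle_W$, $b(\bar R\boldsymbol\phi,w)=0$. ''Independent of the mesh-size'' means: depending only on $\lambda$ and on the constants $C_1,C_2,\alpha,\beta,\bar C_1,\bar C_2,\bar\alpha,\bar C,C_W$. *)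

(* Defs.v *)
From HB Require Import structures.
From mathcomp Require Import all_boot all_order all_algebra.
From mathcomp Require Import all_classical all_reals all_analysis.

Set Implicit Arguments.
Unset Strict Implicit.
Unset Printing Implicit Defensive.

Import Order.TTheory GRing.Theory Num.Theory.
Import numFieldNormedType.Exports.

Local Open Scope classical_set_scope.
Local Open Scope ring_scope.

HB.mixin Record CompleteNormedModule_isHilbert (R : realType) H
    & CompleteNormedModule R H := {
  inner : {dot H for (@idfun R)} ;
  inner_norm : forall x : H, inner x x = `|x| ^+ 2
}.

#[short(type="hilbertType")]
HB.structure Definition Hilbert (R : realType) :=
  {H of CompleteNormedModule_isHilbert R H & CompleteNormedModule R H}.

Section Spaces.
Variable R : realType.

(* X `<=` W `<=` X' with continuous inclusions.  The first inclusion is iota,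
   the second sends w to the functional x |-> <w, iota x>_W. *)
Definition gelfand_triple (X W : hilbertType R) (iota : {linear X -> W}) :=
  [/\ injective iota, continuous iota,
      injective (fun (w : W) (x : X) => inner w (iota x)) &
      exists K : R, forall (w : W) (x : X),
        `|inner w (iota x)| <= K * `|w| * `|x| ].

(* The functional N is only meaningful on the subspace S. *)
Definition is_norm_on (V : lmodType R) (S : set V) (N : V -> R) :=
  [/\ forall x y, S x -> S y -> N (x + y) <= N x + N y,
      forall (c : R) x, S x -> N (c *: x) = `|c| * N x &
      forall x, S x -> N x = 0 -> x = 0].

Definition is_linear_on (V V' : lmodType R) (S : set V) (L : V -> V') :=
  forall (c : R) x y, S x -> S y -> L (c *: x + y) = c *: L x + L y.

(* X + X_h as a subset of W, the two spaces being given by their embeddings. *)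
Definition sum_space (X Xh W : lmodType R)
  (iota : {linear X -> W}) (jX : {linear Xh -> W}) : set W :=
  [set w | exists (v : X) (vh : Xh), w = iota v + jX vh].

(* As usual both bounds range over nonzero vectors.  With extended reals the
   infimum is +oo when P is trivial, so a trivial P is not excluded. *)
Definition inf_sup (U P : lmodType R) (b : U -> P -> R)
    (nU : U -> R) (nP : P -> R) : \bar R :=
  ereal_inf [set ereal_sup [set (b z p / (nU z * nP p))%:E | z in [set z | z != 0]]
            | p in [set p | p != 0]].

Definition is_orthogonal_projection (Q : hilbertType R) (Qh : lmodType R)
    (jQ : {linear Qh -> Q}) (Pi : Q -> Qh) :=
  forall (x : Q) (k : Qh), inner (x - jQ (Pi x)) (jQ k) = 0.

Definition form_kernel (U P : lmodType R) (b : U -> P -> R) : set U :=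
  [set v | forall w, b v w = 0].

End Spaces.

(* The equations are shared by the continuous problem (U = X, P = M), the
   discrete one (U = X_h, P = M_h) and the reconstructions; j : U -> W is the
   embedding of the velocity space into W. *)
Section Systems.
Variables (R : realType) (W Q : hilbertType R) (U P : lmodType R).
Variables (a : U -> U -> R) (b : U -> P -> R) (E : U -> Q) (j : U -> W).

Definition state_system (f : W) (y : Q) (u : U) (p : P) :=
  (forall z : U, a u z + b z p = inner y (E z) + inner f (j z)) /\
  (forall w : P, b u w = 0).

(* In the adjoint system the unknown is the second argument of a. *)
Definition adjoint_system (g : W) (phi : U) (r : P) :=
  (forall z : U, a z phi - b z r = inner g (j z)) /\
  (forall w : P, b phi w = 0).

Definition optimality_system (lambda : R) (Qad : set Q) (f ud : W)
    (u : U) (p : P) (phi : U) (r : P) (y : Q) :=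
  [/\ Qad y,
      state_system f y u p,
      adjoint_system (j u - ud) phi r &
      forall x : Q, Qad x -> 0 <= inner (E phi + lambda *: y) (x - y)].

End Systems.

(* Main.v *)
(** Subtracting the reconstructions from the continuous solution leaves two
    saddle point systems with data [y - yh] and [u - uh].  The inf-sup condition
    bounds [r - Rb0r] by the adjoint data [|u - uh|_W], hence, through the
    stability of the state equation, by [|y - yh|] and [|Ru - uh|_h].  The
    control error comes from adding the two variational inequalities: the term
    [<E (phi - Rbphi), y - yh>] equals [<u - uh, u - Ru>_W] by duality of the two
    systems, so it has the right sign up to [|Ru - uh|_W ^ 2]. *)

Require Import Defs.
From HB Require Import structures.
From mathcomp Require Import all_boot all_order all_algebra.
From mathcomp Require Import all_classical all_reals all_analysis.
From mathcomp Require Import ring lra.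
Import Order.TTheory GRing.Theory Num.Theory.
Import numFieldNormedType.Exports.
Local Open Scope classical_set_scope.
Local Open Scope ring_scope.

(** * Inner product calculus and the Cauchy-Schwarz inequality *)

Lemma innerC {R : realType} {H : hilbertType R} (x y : H) : inner x y = inner y x.
Proof. by rewrite hermC expr0 mul1r. Qed.

Lemma innerZr {R : realType} {H : hilbertType R} (c : R) (x y : H) :
  inner x (c *: y) = c * inner x y.
Proof. exact: (linearZr_LR (inner : {bilinear H -> H -> R | *%R & *%R})). Qed.

Lemma innerZl {R : realType} {H : hilbertType R} (c : R) (x y : H) :
  inner (c *: x) y = c * inner x y.
Proof. by rewrite innerC innerZr innerC. Qed.

Lemma innerBr {R : realType} {H : hilbertType R} (x y z : H) :
  inner x (y - z) = inner x y - inner x z.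
Proof. exact: linearBr. Qed.

Lemma innerBl {R : realType} {H : hilbertType R} (x y z : H) :
  inner (x - y) z = inner x z - inner y z.
Proof. exact: linearBl. Qed.

Lemma innerDl {R : realType} {H : hilbertType R} (x y z : H) :
  inner (x + y) z = inner x z + inner y z.
Proof. exact: linearDl. Qed.

Lemma innerNl {R : realType} {H : hilbertType R} (x y : H) :
  inner (- x) y = - inner x y.
Proof. exact: linearNl. Qed.

(** Expanding the square of [|y| x - |x| y] gives [2 |x| |y| (|x| |y| - <x, y>)], which is
    nonnegative. *)
Lemma ler_inner_norm {R : realType} {H : hilbertType R} (x y : H) :
  inner x y <= `|x| * `|y|.
Proof.
have [->|x0] := eqVneq x 0; first by rewrite linear0l normr0 mul0r.
have [->|y0] := eqVneq y 0; first by rewrite linear0r normr0 mulr0.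
have xy_gt0 : 0 < `|x| * `|y| by rewrite mulr_gt0// normr_gt0.
have := sqr_ge0 (`| `|y| *: x - `|x| *: y |).
rewrite -inner_norm innerBl !innerBr !innerZl !innerZr !inner_norm.
rewrite (innerC y x) => h.
rewrite -(ler_pM2l xy_gt0).
nra.
Qed.

(** At a fixed [p] the infimum is at most the supremum over [z], and every quotient in that supremum
    is at most [K / nP p]. *)
Lemma inf_sup_le {R : realType} {U P : lmodType R} {b : U -> P -> R}
    {nU : U -> R} {nP : P -> R} {beta K : R} {p : P} :
  0 < nP p -> (forall z, z != 0 -> 0 < nU z) ->
  p != 0 -> (beta%:E <= inf_sup b nU nP)%E ->
  (forall z, b z p <= K * nU z) -> beta * nP p <= K.
Proof.
move=> p_gt0 nU_gt0 p0 hb hK.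
rewrite -ler_pdivlMr// -lee_fin.
apply: (le_trans hb); apply: le_trans.
  by apply: ereal_inf_lbound; exists p.
apply: ge_ereal_sup => _ [z z0 <-]; rewrite lee_fin.
have z_gt0 := nU_gt0 _ z0.
rewrite ler_pdivrMr ?mulr_gt0//.
suff -> : K / nP p * (nU z * nP p) = K * nU z by [].
by field; rewrite gt_eqF.
Qed.

(** By contradiction: the summand [+ 1] makes [t] at least [s], so that [c * s ^+ 2 <= c * s * t],
    and dividing by [t] leaves a linear inequality. *)
Lemma le_of_quadratic_le {R : realFieldType} {l c s t : R} :
  0 < l -> 0 <= c -> 0 <= s -> l * t ^+ 2 <= s * t + c * s ^+ 2 ->
  t <= ((1 + c) / l + 1) * s.
Proof.
move=> l0 c0 s0 h; rewrite leNgt; apply/negP => lt_t.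
have K0 : 0 <= (1 + c) / l by rewrite divr_ge0 ?addr_ge0// ltW.
have st : s <= t by apply: le_trans (ltW lt_t); rewrite ler_peMl// lerDr.
have t0 : 0 < t by apply: le_lt_trans lt_t; rewrite mulr_ge0// addr_ge0.
have cst : c * s ^+ 2 <= c * s * t by rewrite expr2 mulrA ler_wpM2l ?mulr_ge0.
have lt_le : l * t <= (1 + c) * s.
  by rewrite -(ler_pM2r t0); apply: (le_trans _ (le_trans h _)); lra.
have : l * (((1 + c) / l + 1) * s) < l * t by rewrite ltr_pM2l.
have -> : l * (((1 + c) / l + 1) * s) = (1 + c) * s + l * s.
  by field; rewrite gt_eqF.
have : 0 <= l * s by rewrite mulr_ge0// ltW.
lra.
Qed.

(** * Stability and duality of the continuous saddle point systems *)

Section Saddle.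
Context {R : realType} {X M W Q : hilbertType R}.
Context {a : {bilinear X -> X -> R | *%R & *%R}}.
Context {b : {bilinear X -> M -> R | *%R & *%R}}.
Context {E : {linear X -> Q}} {j : {linear X -> W}}.

Lemma state_systemB {f y1 u1 p1 y2 u2 p2} :
  state_system a b E j f y1 u1 p1 -> state_system a b E j f y2 u2 p2 ->
  state_system a b E j 0 (y1 - y2) (u1 - u2) (p1 - p2).
Proof.
move=> [h1 d1] [h2 d2]; split=> [z|w]; last by rewrite linearBl d1 d2 subrr.
have := h1 z; have := h2 z.
rewrite innerBl linear0l linearBl linearBr => e1 e2.
lra.
Qed.

Lemma adjoint_systemB {g1 phi1 r1 g2 phi2 r2} :
  adjoint_system a b j g1 phi1 r1 -> adjoint_system a b j g2 phi2 r2 ->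
  adjoint_system a b j (g1 - g2) (phi1 - phi2) (r1 - r2).
Proof.
move=> [h1 d1] [h2 d2]; split=> [z|w]; last by rewrite linearBl d1 d2 subrr.
have := h1 z; have := h2 z.
rewrite innerBl !linearBr => e1 e2.
lra.
Qed.

(** Test the state equation with [phi] and the adjoint equation with [u]: both lie in the kernel of
    [b], so both sides equal [a u phi]. *)
Lemma state_adjoint_duality {y u p g phi r} :
  state_system a b E j 0 y u p -> adjoint_system a b j g phi r ->
  inner y (E phi) = inner g (j u).
Proof.
move=> [h d] [h' d'].
by have := h phi; have := h' u; rewrite linear0l d d' => <- /esym; lra.
Qed.

Context {alpha c : R}.
Hypothesis alpha_gt0 : 0 < alpha.
Hypothesis a_elliptic :
  forall v : X, form_kernel b v -> alpha * `|v| ^+ 2 <= a v v.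

Lemma elliptic_norm_le (v : X) (K : R) : 0 <= K ->
  form_kernel b v -> a v v <= K * `|v| -> `|v| <= K / alpha.
Proof.
move=> K0 /a_elliptic hv hK; rewrite ler_pdivlMr//.
have [->|v0] := eqVneq v 0; first by rewrite normr0 mul0r.
have v_gt0 : 0 < `|v| by rewrite normr_gt0.
rewrite -(ler_pM2r v_gt0); nra.
Qed.

Lemma state_norm_le {y u p} : (forall v, `|E v| <= `|v|) ->
  state_system a b E j 0 y u p -> `|u| <= `|y| / alpha.
Proof.
move=> E_le [h d]; apply: elliptic_norm_le => //.
have := h u; rewrite d addr0 linear0l addr0 => ->.
by apply: (le_trans (ler_inner_norm _ _)); rewrite ler_wpM2l.
Qed.

Hypothesis j_le : forall v, `|j v| <= c * `|v|.
Hypothesis c_ge0 : 0 <= c.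

Lemma adjoint_norm_le {g phi r} :
  adjoint_system a b j g phi r -> `|phi| <= c * `|g| / alpha.
Proof.
move=> [h d]; apply: elliptic_norm_le; rewrite ?mulr_ge0//.
have := h phi; rewrite d subr0 => ->.
apply: (le_trans (ler_inner_norm _ _)).
by rewrite -mulrA mulrCA ler_wpM2l.
Qed.

(** The adjoint equation expresses [b z r] as [a z phi - <g, j z>]. The first term contributes
    [C1 / alpha] through the bound on [phi], the second contributes [1]; the inf-sup condition
    divides by [beta]. *)
Lemma adjoint_pressure_norm_le {C1 beta : R} {g phi r} :
  0 <= C1 -> 0 < beta ->
  (forall v z : X, `|a v z| <= C1 * `|v| * `|z|) ->
  (beta%:E <=
     (inf_sup b (fun z : X => `|z|) (fun p : M => `|p|))%R)%E ->
  adjoint_system a b j g phi r ->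
  `|r| <= (C1 / alpha + 1) * c / beta * `|g|.
Proof.
move=> C1_ge0 beta_gt0 a_le b_is adj; have [h d] := adj.
have [->|r0] := eqVneq r 0.
  by rewrite normr0 !mulr_ge0 ?invr_ge0 ?addr_ge0 ?mulr_ge0 ?invr_ge0// ltW.
rewrite [leRHS]mulrAC ler_pdivlMr// mulrC.
apply: (inf_sup_le _ _ r0 b_is); rewrite ?normr_gt0//.
  by move=> z; rewrite normr_gt0.
move=> z; have := h z.
have phi_le := adjoint_norm_le adj.
have a1 := le_trans (ler_norm _) (a_le z phi).
have g1 : - inner g (j z) <= c * `|g| * `|z|.
  rewrite -innerNl; apply: (le_trans (ler_inner_norm _ _)).
  by rewrite normrN mulrAC [leRHS]mulrC ler_wpM2l// [leRHS]mulrC.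
have a2 : C1 * `|z| * `|phi| <= C1 * `|z| * (c * `|g| / alpha).
  by rewrite ler_wpM2l// mulr_ge0.
move=> e.
have -> : b z r = a z phi - inner g (j z) by rewrite -e; ring.
have -> : (C1 / alpha + 1) * c * `|g| * `|z| =
  C1 * `|z| * (c * `|g| / alpha) + c * `|g| * `|z| by ring.
lra.
Qed.

End Saddle.

(* The discrete inequality is tested with the projection of the continuous
   control; orthogonality removes the projection wherever it meets [Q_h]. *)
Lemma control_error_le {R : realType} {Q : hilbertType R} {Qh : lmodType R}
    {jQ : {linear Qh -> Q}} {Pi : Q -> Qh} {Qad Qadh : set Q} {lambda : R}
    {q qh y yh : Q} :
  is_orthogonal_projection jQ Pi -> Qadh `<=` Qad -> Qadh `<=` range jQ ->
  (forall x, Qad x -> Qadh (jQ (Pi x))) -> Qad y -> Qadh yh ->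
  (forall x, Qad x -> 0 <= inner (q + lambda *: y) (x - y)) ->
  (forall x, Qadh x -> 0 <= inner (qh + lambda *: yh) (x - yh)) ->
  lambda * `|y - yh| ^+ 2 <= inner (jQ (Pi qh) - q) (y - yh).
Proof.
move=> hPi sub subQ A3 Qy Qyh VI VIh.
have [k _ ek] := subQ _ Qyh.
have proj x z : inner (jQ (Pi x)) (jQ z) = inner x (jQ z).
  by apply/esym/eqP; rewrite -subr_eq0 -innerBl hPi.
have qh_yh : inner (jQ (Pi qh)) yh = inner qh yh by rewrite -ek proj.
have y_yh : inner yh (jQ (Pi y)) = inner yh y.
  by rewrite innerC [RHS]innerC -ek proj.
have qh_y : inner qh (jQ (Pi y)) = inner (jQ (Pi qh)) y.
  by rewrite -proj innerC proj innerC.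
(* The continuous inequality is tested with [yh], the discrete one with the projection of [y]; in
   their sum the [lambda] terms form [- lambda * |y - yh| ^+ 2]. *)
have := VI _ (sub _ Qyh); have := VIh _ (A3 _ Qy).
rewrite -inner_norm !innerBl !innerDl !innerZl !innerBr.
rewrite qh_yh y_yh qh_y (innerC yh y).
lra.
Qed.

Theorem theorem2p10 (R : realType)
    (lambda C1 C2 alpha beta C1bar C2bar alphabar Cbar CW : R)
    (lambda_gt0 : 0 < lambda) (alpha_gt0 : 0 < alpha) (beta_gt0 : 0 < beta)
    (alphabar_gt0 : 0 < alphabar) (Cbar_gt0 : 0 < Cbar) :
  exists C : R, 0 < C /\
  forall
    (* continuous setting *)
    (X M W Q : hilbertType R)
    (iota : {linear X -> W}) (E : {linear X -> Q}) (Qad : set Q) (f ud : W)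
    (a : {bilinear X -> X -> R | *%R & *%R})
    (b : {bilinear X -> M -> R | *%R & *%R})
    (iota_triple : gelfand_triple iota)
    (E_cont : continuous E)
    (Qad_neq0 : Qad !=set0) (Qad_closed : closed Qad) (Qad_convex : convex_set Qad)
    (a_cont : continuous (fun vz : X * X => a vz.1 vz.2))
    (b_cont : continuous (fun zp : X * M => b zp.1 zp.2))
    (a_bounded : forall v z : X, `|a v z| <= C1 * `|v| * `|z|)
    (b_bounded : forall (z : X) (p : M), `|b z p| <= C2 * `|z| * `|p|)
    (a_elliptic : forall v : X, form_kernel b v -> alpha * `|v| ^+ 2 <= a v v)
    (b_inf_sup : (beta%:E <=
       (inf_sup b (fun z : X => `|z|) (fun p : M => `|p|))%R)%E)
    (* discrete setting *)
    (Xh Mh Qh : vectType R)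
    (jX : {linear Xh -> W}) (jM : {linear Mh -> M}) (jQ : {linear Qh -> Q})
    (nh : W -> R) (Qadh : set Q)
    (ah : {bilinear Xh -> Xh -> R | *%R & *%R})
    (bh : {bilinear Xh -> Mh -> R | *%R & *%R})
    (Eh : W -> Q) (Pih : Q -> Qh)
    (jX_inj : injective jX) (jM_inj : injective jM) (jQ_inj : injective jQ)
    (nh_norm : is_norm_on (sum_space iota jX) nh)
    (nhX : forall v : X, nh (iota v) = `|v|)
    (Qadh_sub : Qadh `<=` Qad) (Qadh_subQh : Qadh `<=` range jQ)
    (Qadh_neq0 : Qadh !=set0) (Qadh_closed : closed Qadh)
    (Qadh_convex : convex_set Qadh)
    (ah_bounded : forall vh zh : Xh,
       `|ah vh zh| <= C1bar * nh (jX vh) * nh (jX zh))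
    (bh_bounded : forall (zh : Xh) (ph : Mh),
       `|bh zh ph| <= C2bar * nh (jX zh) * `|jM ph|)
    (ah_elliptic : forall vh : Xh, form_kernel bh vh ->
       alphabar * nh (jX vh) ^+ 2 <= ah vh vh)
    (bh_inf_sup : (Cbar%:E <=
       (inf_sup bh (fun zh : Xh => nh (jX zh)) (fun ph : Mh => `|jM ph|))%R)%E)
    (Eh_linear : is_linear_on (sum_space iota jX) Eh)
    (EhX : forall v : X, Eh (iota v) = E v)
    (* standing assumptions *)
    (A1 : forall v : W, sum_space iota jX v -> `|v| <= CW * nh v)
    (A2 : forall (v : X) (vh : Xh),
       `|Eh (iota v - jX vh)| <= nh (iota v - jX vh))
    (Pih_proj : is_orthogonal_projection jQ Pih)
    (A3 : forall x : Q, Qad x -> Qadh (jQ (Pih x)))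
    (* solutions and reconstructions *)
    (u : X) (p : M) (phi : X) (r : M) (y : Q)
    (sol : optimality_system a b E iota lambda Qad f ud u p phi r y)
    (uh : Xh) (ph : Mh) (phih : Xh) (rh : Mh) (yh : Q)
    (solh : optimality_system ah bh (Eh \o jX) jX lambda Qadh f ud
              uh ph phih rh yh)
    (Ru : X) (R0p : M) (Rbphi : X) (Rb0r : M)
    (recu : state_system a b E iota f yh Ru R0p)
    (recphi : adjoint_system a b iota (jX uh - ud) Rbphi Rb0r),
  `|r - jM rh| <=
    C * (`|Rb0r - jM rh| + `|Eh (jX phih) - jQ (Pih (Eh (jX phih)))|
         + nh (iota Ru - jX uh) + nh (jX phih - iota Rbphi)).
Proof.
(* Absolute values, since no sign is assumed for [CW] and [C1]. [K] bounds the control error, [D]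
   the adjoint pressure in terms of its data. *)
pose c := `|CW|.
pose K := (1 + c ^+ 2) / lambda + 1.
pose D := (`|C1| / alpha + 1) * c / beta.
have c_ge0 : 0 <= c by exact: normr_ge0.
have K_ge0 : 0 <= K by rewrite addr_ge0// divr_ge0 ?addr_ge0 ?sqr_ge0// ltW.
have D_ge0 : 0 <= D.
  by rewrite divr_ge0 ?mulr_ge0 ?addr_ge0// ?divr_ge0// ltW.
have L_ge0 : 0 <= c * (K / alpha + 1).
  by rewrite mulr_ge0// addr_ge0// divr_ge0// ltW.
exists (1 + D * (c * (K / alpha + 1))); split.
  by rewrite ltr_wpDr// mulr_ge0.
move=> X M W Q iota E Qad f ud a b _ _ _ _ _ _ _ a_bounded _ a_elliptic
  b_inf_sup Xh Mh Qh jX jM jQ nh Qadh ah bh Eh Pih _ _ _ nh_norm nhX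
  Qadh_sub Qadh_subQh _ _ _ _ _ _ _ Eh_linear EhX A1 A2 Pih_proj A3
  u p phi r y [Qy state_u adj_phi VI] uh ph phih rh yh [Qyh _ _ VIh]
  Ru R0p Rbphi Rb0r recu recphi.
have S_iota v : sum_space iota jX (iota v).
  by exists v, 0; rewrite linear0 addr0.
have S_jX vh : sum_space iota jX (jX vh).
  by exists 0, vh; rewrite linear0 add0r.
have S_sub v vh : sum_space iota jX (iota v - jX vh).
  by exists v, (- vh); rewrite linearN.
(* [is_norm_on] does not list nonnegativity; on these differences it is read off from [A2]. *)
have nh_ge0 v vh : 0 <= nh (iota v - jX vh) := le_trans (normr_ge0 _) (A2 v vh).
have W_le v vh : `|iota v - jX vh| <= c * nh (iota v - jX vh).
  by apply: le_trans (A1 _ (S_sub v vh)) _; rewrite ler_wpM2r// ler_norm.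
have iota_le v : `|iota v| <= c * `|v|.
  by have := W_le v 0; rewrite linear0 subr0 nhX.
have Eh_sub v vh : Eh (iota v - jX vh) = E v - Eh (jX vh).
  rewrite -EhX addrC -scaleN1r Eh_linear//.
  by rewrite scaleN1r addrC.
have E_le v : `|E v| <= `|v|.
  by have := A2 v 0; rewrite linear0 subr0 EhX nhX.
have nh_sym v vh : nh (jX vh - iota v) = nh (iota v - jX vh).
  have [_ nhZ _] := nh_norm.
  by rewrite -opprB -scaleN1r nhZ// normrN1 mul1r.
set G := `|Rb0r - jM rh|; set P := `|_ - jQ _|.
set U := nh (iota Ru - jX uh); set F := nh (jX phih - iota Rbphi).
have U_ge0 : 0 <= U := nh_ge0 _ _.
have F_ge0 : 0 <= F by rewrite /F nh_sym.
have P_ge0 : 0 <= P by exact: normr_ge0.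
have s_ge0 : 0 <= P + U + F by rewrite !addr_ge0.
have U_le : U <= P + U + F by lra.
pose g := iota u - jX uh.
have state_e := state_systemB state_u recu.
have := adjoint_systemB adj_phi recphi.
(* The desired state [ud] cancels, leaving [g] as the adjoint data. *)
rewrite opprB addrA subrK -/g => adj_e.
have duality := state_adjoint_duality state_e adj_e.
have g_split : g = iota (u - Ru) + (iota Ru - jX uh).
  by rewrite (linearB iota) addrA subrK.
have VI_err := control_error_le Pih_proj Qadh_sub Qadh_subQh A3 Qy Qyh VI VIh.
have rho_le := W_le Ru uh; rewrite -/U in rho_le.
have y_le : `|y - yh| <= K * (P + U + F).
  apply: le_of_quadratic_le; rewrite ?sqr_ge0//.
  apply: (le_trans VI_err).
  (* Three parts: the projection error, the adjoint reconstruction error, and the remainder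
     [E (phi - Rbphi)], to which duality applies. *)
  have -> : jQ (Pih (Eh (jX phih))) - E phi =
      - (Eh (jX phih) - jQ (Pih (Eh (jX phih))))
      - Eh (iota Rbphi - jX phih) - E (phi - Rbphi).
    by rewrite Eh_sub (linearB E) !opprB !addrA !subrK.
  rewrite 2!innerBl innerNl [inner (E _) _]innerC duality.
  have P_le : - inner (Eh (jX phih) - jQ (Pih (Eh (jX phih)))) (y - yh)
      <= P * `|y - yh|.
    by rewrite -innerNl (le_trans (ler_inner_norm _ _))// normrN.
  have F_le : - inner (Eh (iota Rbphi - jX phih)) (y - yh) <= F * `|y - yh|.
    rewrite -innerNl (le_trans (ler_inner_norm _ _))// normrN ler_wpM2r//.
    by rewrite /F nh_sym A2.
  (* The error of the adjoint state meets the control error in [|iota (u - Ru)|^2],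
     whose sign is favourable and absorbs the cross term. *)
  have g_ge : - inner g (iota (u - Ru)) <= c ^+ 2 * U ^+ 2.
    rewrite g_split innerDl inner_norm.
    have := ler_inner_norm (- (iota Ru - jX uh)) (iota (u - Ru)).
    rewrite innerNl normrN -exprMn.
    set A := `|iota _|; set B := `|_ - jX _| in rho_le *.
    have B_ge0 : 0 <= B by exact: normr_ge0.
    have : B ^+ 2 <= (c * U) ^+ 2 by rewrite lerXn2r ?nnegrE ?mulr_ge0.
    have := sqr_ge0 (A - B); have := sqr_ge0 A; have := sqr_ge0 B.
    rewrite !expr2; lra.
  (* The estimate so far is [(P + F) * t + c ^+ 2 * U ^+ 2] with [t] the control error; both terms
     are enlarged to the common [s = P + U + F]. *)
  have U2_le : U ^+ 2 <= (P + U + F) ^+ 2 by rewrite lerXn2r ?nnegrE.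
  have : c ^+ 2 * U ^+ 2 <= c ^+ 2 * (P + U + F) ^+ 2.
    by rewrite ler_wpM2l ?sqr_ge0.
  have : 0 <= U * `|y - yh| by rewrite mulr_ge0.
  lra.
have u_le := state_norm_le alpha_gt0 a_elliptic E_le state_e.
(* [K / alpha] comes from [u - Ru] via the control error, [1] from [Ru - uh]; [c] passes to the norm
   of [W]. *)
have g_le : `|g| <= c * (K / alpha + 1) * (P + U + F).
  rewrite g_split (le_trans (ler_normD _ _))//.
  rewrite (le_trans (lerD (iota_le _) rho_le))// -mulrDr -mulrA ler_wpM2l//.
  rewrite mulrDl mul1r lerD// (le_trans u_le)// mulrAC ler_wpM2r//.
  by rewrite invr_ge0 ltW.
have a_le v z : `|a v z| <= `|C1| * `|v| * `|z|.
  by rewrite (le_trans (a_bounded v z))// !ler_wpM2r// ler_norm.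
have r_le : `|r - Rb0r| <= D * `|g|.
  exact: (adjoint_pressure_norm_le alpha_gt0 a_elliptic iota_le c_ge0
    (normr_ge0 C1) beta_gt0 a_le b_inf_sup adj_e).
have -> : r - jM rh = (r - Rb0r) + (Rb0r - jM rh) by rewrite addrA subrK.
apply: (le_trans (ler_normD _ _)); rewrite -/G.
have G_ge0 : 0 <= G by exact: normr_ge0.
have := ler_wpM2l D_ge0 g_le.
(* With [L = D * (c * (K / alpha + 1))] and [s = P + U + F], the bound [G + L * s] is at most
   [(1 + L) * (G + s)] because [L * G] and [s] are nonnegative. *)
have : 0 <= D * (c * (K / alpha + 1)) * G by rewrite mulr_ge0// mulr_ge0.
rewrite !mulrA; lra.
Qed.
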